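(* Let $G$ be a linearly ordered $d$-group. Let $\overline S$ be either $\overline{\mathscr{B}}(G)$ or $\overline{\mathscr{B}}^+(G)$, and let $\mathfrak{C}_{mg}$ be the least group congruence on $\overline S$. Then the quotient semigroup $\overline S/\mathfrak{C}_{mg}$ is antiisomorphic to the group $G$.
   Context: A linearly ordered group is a group $G$ (identity $e$) with a total order $\leqslant$ such that $a\leqslant b$ implies $ag\leqslant bg$ and $ga\leqslant gb$ for all $a,b,g\in G$; $G^+=\{x\in G: e\leqslant x\}$. $G$ is a $d$-group if for every $g\in G^+\setminus\{e\}$ there is $x\in G^+\setminus\{e\}$ with $x<g$. For $g,h\in G$, $\alpha^g_h$ (resp. $\overset{\circ}{\alpha}{}^g_h$) is the partial map $G\rightharpoonup G$ with domain $\{x\in G: g\leqslant x\}$ (resp. $\{x\in G: g<x\}$) given by $x\mapsto x g^{-1}h$. Put $\overline{\mathscr{B}}(G)=\{\alpha^g_h: g,h\in G\}\cup\{\overset{\circ}{\alpha}{}^g_h: g,h\in G\}$ and $\overline{\mathscr{B}}^+(G)=\{\alpha^g_h: g,h\in G^+\}\cup\{\overset{\circ}{\alpha}{}^g_h: g,h\in G^+\}$. These are inverse semigroups under composition of partial maps (maps written on the right, $x(\alpha\beta)=(x\alpha)\beta$ for $x\in\operatorname{dom}\alpha$ with $x\alpha\in\operatorname{dom}\beta$). A group congruence on a semigroup is a congruence whose quotient is a group; every inverse semigroup $S$ has a least group congruence, given by $a\mathfrak{C}_{mg}b$ iff $a\varepsilon=b\varepsilon$ for some idempotent $\varepsilon\in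 S$. An antiisomorphism is a bijection $h$ with $(a\cdot b)h=(b)h\cdot(a)h$. *)

(* Defs.v *)
From HB Require Import structures.
From mathcomp Require Import all_boot all_order.
From mathcomp Require Import boolp.

Set Implicit Arguments.
Unset Strict Implicit.
Unset Printing Implicit Defensive.

Import Order.TTheory.
Local Open Scope group_scope.
Local Open Scope order_scope.

HB.mixin Record isOrderedGroup (d : Order.disp_t) G
    of Group G & Order.Total d G := {
  le_mulgr : forall a b g : G, a <= b -> (a * g)%g <= (b * g)%g;
  le_mulgl : forall a b g : G, a <= b -> (g * a)%g <= (g * b)%g
}.

#[short(type="loGroupType")]
HB.structure Definition LOGroup (d : Order.disp_t) :=
  {G of isOrderedGroup d G & Group G & Order.Total d G}.

Definition pos_cone (d : Order.disp_t) (G : loGroupType d) (x : G) : bool :=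
  1%g <= x.

Definition d_group (d : Order.disp_t) (G : loGroupType d) : Prop :=
  forall g : G, pos_cone g -> g <> 1%g ->
    exists x : G, [/\ pos_cone x, x <> 1%g & x < g].

(* Partial maps T -> T, composed from left to right because maps act on the
   right: x (f * g) = (x f) g. *)
Definition partial_map (T : Type) : Type := T -> option T.
HB.instance Definition _ (T : Type) := gen_eqMixin (partial_map T).
HB.instance Definition _ (T : Type) := gen_choiceMixin (partial_map T).

Definition partial_map_mul (T : Type) (f g : partial_map T) : partial_map T :=
  fun x => obind g (f x).

Lemma partial_map_mulA (T : Type) : associative (@partial_map_mul T).
Proof.
move=> f g h; apply: funext => x; rewrite /partial_map_mul.
by case: (f x).
Qed.

HB.instance Definition _ (T : Type) :=
  isSemigroup.Build (partial_map T) (@partial_map_mulA T).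

Section Translations.
Variables (d : Order.disp_t) (G : loGroupType d).
Implicit Types g h k l x y z : G.

Definition alpha g h : partial_map G :=
  fun x => if g <= x then Some (x * g^-1 * h)%g else None.

Definition alphao g h : partial_map G :=
  fun x => if g < x then Some (x * g^-1 * h)%g else None.

Definition Bbar_pred : {pred partial_map G} :=
  [pred f | `[< exists g h, f = alpha g h \/ f = alphao g h >]].

Definition Bbarp_pred : {pred partial_map G} :=
  [pred f | `[< exists g h,
    [/\ pos_cone g, pos_cone h & f = alpha g h \/ f = alphao g h] >]].

Lemma le_mulgIr z x y : (x * z <= y * z)%g = (x <= y).
Proof.
apply/idP/idP => [/(@le_mulgr _ _ _ _ z^-1)|]; last exact: le_mulgr.
by rewrite !mulgK.
Qed.

Lemma lt_mulgIr z x y : (x * z < y * z)%g = (x < y).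
Proof. by rewrite !ltNge le_mulgIr. Qed.

Let gen (C : bool) g h : partial_map G := if C then alpha g h else alphao g h.

Let genE C g h x :
  gen C g h x = if g < x ?<= if C then Some (x * g^-1 * h)%g else None.
Proof. by case: C. Qed.

Let gen_mul C D g h k l : exists E m n,
  gen C g h * gen D k l = gen E m n /\
  ((m, n) = (g, h * k^-1 * l)%g /\ k <= h \/
   (m, n) = (k * h^-1 * g, l)%g /\ h <= k).
Proof.
have shift x : (k < (x * g^-1 * h)%g ?<= if D) =
               ((k * h^-1 * g)%g < x ?<= if D).
  have e : (k * h^-1 * g * (g^-1 * h))%g = k by rewrite mulgA mulgK mulgVK.
  rewrite -{1}e -[(x * _ * h)%g]mulgA.
  by case: (D); rewrite /= ?le_mulgIr ?lt_mulgIr.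
have val x : (x * g^-1 * h * k^-1 * l)%g = (x * (k * h^-1 * g)^-1 * l)%g.
  by rewrite !invgM invgK !mulgA.
have lekg : k <= h -> (k * h^-1 * g)%g <= g.
  by move=> kh; rewrite -[leRHS]mul1g le_mulgIr -(mulgV h) le_mulgIr.
have ltkg : k < h -> (k * h^-1 * g)%g < g.
  by move=> kh; rewrite -[ltRHS]mul1g lt_mulgIr -(mulgV h) lt_mulgIr.
have ltgk : h < k -> g < (k * h^-1 * g)%g.
  by move=> kh; rewrite -[ltLHS]mul1g lt_mulgIr -(mulgV h) lt_mulgIr.
have prodE x : (gen C g h * gen D k l)%g x =
    if (g < x ?<= if C) && ((k * h^-1 * g)%g < x ?<= if D)
    then Some (x * g^-1 * h * k^-1 * l)%g else None.
  rewrite /mul /= /partial_map_mul genE.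
  by case: ifP => //= _; rewrite genE shift.
case: (ltgtP k h) => [kh|hk|ekh].
- exists C, g, (h * k^-1 * l)%g; split; last by left.
  apply: funext => x; rewrite prodE genE !mulgA.
  suff -> : (g < x ?<= if C) && ((k * h^-1 * g)%g < x ?<= if D) =
            (g < x ?<= if C) by [].
  apply: andb_idr => gx.
  have {gx} gx : g <= x by case: (C) gx => //= /ltW.
  by apply: (@lteifS _ _ _ _ D); apply: lt_le_trans gx; apply: ltkg.
- exists D, (k * h^-1 * g)%g, l; split; last by right.
  apply: funext => x; rewrite prodE genE val.
  suff -> : (g < x ?<= if C) && ((k * h^-1 * g)%g < x ?<= if D) =
            ((k * h^-1 * g)%g < x ?<= if D) by [].
  apply: andb_idl => gx.
  have {gx} gx : (k * h^-1 * g)%g <= x by case: (D) gx => //= /ltW.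
  by apply: (@lteifS _ _ _ _ C); apply: lt_le_trans gx; apply: ltgk.
- exists (C && D), g, (h * k^-1 * l)%g; split; last by left.
  apply: funext => x; rewrite prodE genE !mulgA ekh mulgV mul1g.
  suff -> : (g < x ?<= if C) && (g < x ?<= if D) =
            (g < x ?<= if C && D) by [].
  by case: (C) (D) => -[] //=; rewrite ?andbb //; case: ltgtP.
Qed.

Let genP f g h : f = alpha g h \/ f = alphao g h <-> exists C, f = gen C g h.
Proof.
split=> [[->|->]|[[] ->]]; by [exists true|exists false|left|right].
Qed.

Lemma Bbar_mulg_closed : mulg_closed Bbar_pred.
Proof.
move=> u v; rewrite !inE => /asboolP[g [h /genP[C ->]]].
move=> /asboolP[k [l /genP[D ->]]]; apply/asboolP.
have [E [m [n [-> _]]]] := gen_mul C D g h k l.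
by exists m, n; apply/genP; exists E.
Qed.

Lemma Bbarp_mulg_closed : mulg_closed Bbarp_pred.
Proof.
have pos (a b c : G) : b <= a -> pos_cone c -> pos_cone (a * b^-1 * c)%g.
  rewrite /pos_cone => ba c1; apply: le_trans c1 _.
  by rewrite -[leLHS]mul1g le_mulgIr -(mulgV b) le_mulgIr.
move=> u v; rewrite !inE => /asboolP[g [h [g1 h1 /genP[C ->]]]].
move=> /asboolP[k [l [k1 l1 /genP[D ->]]]]; apply/asboolP.
have [E [m [n [-> emn]]]] := gen_mul C D g h k l.
have gE : gen E m n = alpha m n \/ gen E m n = alphao m n.
  by apply/genP; exists E.
exists m, n; split=> //; case: emn => -[[em en] le]; rewrite ?em ?en //; exact: pos.
Qed.

Record Bbar : Type := MkBbar { Bbar_val :> partial_map G; _ : Bbar_val \in Bbar_pred }.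
HB.instance Definition _ := [isSub for Bbar_val].
HB.instance Definition _ := [Choice of Bbar by <:].
HB.instance Definition _ :=
  SubChoice_isSubSemigroup.Build (partial_map G) Bbar_pred Bbar Bbar_mulg_closed.

Record Bbarp : Type :=
  MkBbarp { Bbarp_val :> partial_map G; _ : Bbarp_val \in Bbarp_pred }.
HB.instance Definition _ := [isSub for Bbarp_val].
HB.instance Definition _ := [Choice of Bbarp by <:].
HB.instance Definition _ :=
  SubChoice_isSubSemigroup.Build (partial_map G) Bbarp_pred Bbarp Bbarp_mulg_closed.

End Translations.

Record congruence (S : semigroupType) := Congruence {
  cong_rel :> equiv_rel S;
  congM : forall a b c e : S,
    cong_rel a b -> cong_rel c e -> cong_rel (a * c)%g (b * e)%g
}.

Section Quotient.
Local Open Scope quotient_scope.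
Variables (S : semigroupType) (C : congruence S).

Definition quotient : Type := {eq_quot C}.
HB.instance Definition _ := Choice.on quotient.
HB.instance Definition _ := EqQuotient.on quotient.

Definition quot_mul := lift_op2 quotient (@mul S).

Lemma pi_quot_mul : {morph \pi_quotient : a b / (a * b)%g >-> quot_mul a b}.
Proof.
move=> a b; unlock quot_mul; apply/eqmodP/congM;
  by rewrite equiv_sym; apply/eqmodP; rewrite reprK.
Qed.

Lemma quot_mulA : associative quot_mul.
Proof.
by move=> x y z; rewrite -[x]reprK -[y]reprK -[z]reprK -!pi_quot_mul mulgA.
Qed.

HB.instance Definition _ := isSemigroup.Build quotient quot_mulA.
End Quotient.

Definition is_group (S : semigroupType) : Prop :=
  exists e : S, [/\ left_id e (@mul S), right_id e (@mul S) &
    forall x : S, exists y : S, (y * x)%g = e /\ (x * y)%g = e].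

Definition group_congruence (S : semigroupType) (C : congruence S) : Prop :=
  is_group (quotient C).

Definition least_group_congruence (S : semigroupType) (C : congruence S) :
    Prop :=
  group_congruence C /\
  forall D : congruence S, group_congruence D -> forall a b, C a b -> D a b.

Definition antiisomorphic (S T : semigroupType) : Prop :=
  exists h : S -> T, bijective h /\ forall a b, h (a * b)%g = (h b * h a)%g.

(* Main.v *)
Require Import Defs.
From mathcomp Require Import all_boot all_order.
From mathcomp Require Import boolp.

(** The map sending [x |-> x * g^-1 * h] to [g^-1 * h] is a surjective morphism
    onto [G], because right translations which agree on a final segment of [G]
    are equal.  Two elements with the same image agree on a final segment, so
    they become equal after multiplication on the left by the identity map of
    a smaller final segment; hence every group congruence identifies them.
    The kernel is thus the least group congruence, the quotient is isomorphic
    to [G], and inversion turns the isomorphism into an antiisomorphism. *)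

Set Implicit Arguments.
Unset Strict Implicit.
Unset Printing Implicit Defensive.

Import Order.TTheory.

Section LeastGroupCongruence.
Local Open Scope group_scope.
Local Open Scope quotient_scope.
Variables (S : semigroupType) (T : groupType) (phi : S -> T).
Hypothesis phiM : {morph phi : a b / a * b}.
Hypothesis phi_surj : forall u, exists s, phi s = u.

Let ker_rel : rel S := fun a b => phi a == phi b.

Let ker_rel_refl : reflexive ker_rel.
Proof. by move=> a; rewrite /ker_rel. Qed.

Let ker_rel_sym : symmetric ker_rel.
Proof. by move=> a b; rewrite /ker_rel eq_sym. Qed.

Let ker_rel_trans : transitive ker_rel.
Proof. by move=> b a c; rewrite /ker_rel => /eqP->. Qed.

Definition ker_equiv : equiv_rel S :=
  EquivRel ker_rel ker_rel_refl ker_rel_sym ker_rel_trans.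

Lemma ker_equivM (a b c e : S) :
  ker_equiv a b -> ker_equiv c e -> ker_equiv (a * c) (b * e).
Proof. by rewrite /= /ker_rel !phiM => /eqP-> /eqP->. Qed.

Definition ker_cong : congruence S := Congruence ker_equivM.

Lemma quotient_piP (C : congruence S) (a b : S) :
  reflect (\pi_(quotient C) a = \pi_(quotient C) b) (C a b).
Proof. exact: (iffP (eqmodP _ _ _)). Qed.

Lemma quotient_piM (C : congruence S) :
  {morph \pi_(quotient C) : a b / a * b}.
Proof. exact: pi_quot_mul. Qed.

Lemma ker_cong_group : group_congruence ker_cong.
Proof.
have [e phie] := phi_surj 1.
have piE a b : phi a = phi b -> \pi_(quotient ker_cong) a = \pi b.
  by move=> ab; apply/quotient_piP/eqP.
exists (\pi e); split=> [q|q|q]; rewrite -[q]reprK.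
- by rewrite -quotient_piM; apply: piE; rewrite phiM phie mul1g.
- by rewrite -quotient_piM; apply: piE; rewrite phiM phie mulg1.
- have [s phis] := phi_surj (phi (repr q))^-1.
  exists (\pi s); rewrite -!quotient_piM.
  by split; apply: piE; rewrite phiM phis phie ?mulVg ?mulgV.
Qed.

(** Leastness puts [C] inside the kernel of [phi]; conversely, [c * a = c * b] can be cancelled in
    the group [quotient C]. So [C] is exactly the kernel. *)
Lemma least_group_congruence_antiiso (C : congruence S) :
  (forall a b, phi a = phi b -> exists c, c * a = c * b) ->
  least_group_congruence C -> antiisomorphic (quotient C) T.
Proof.
move=> phi_cancel [[e [mule _ invC]] leastC].
have CE a b : \pi_(quotient C) a = \pi b <-> phi a = phi b.
  split=> [/quotient_piP/(leastC _ ker_cong_group)/eqP //|].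
  move=> /phi_cancel[c /(congr1 (\pi_(quotient C)))].
  rewrite !quotient_piM; have [y [yc _]] := invC (\pi c).
  by move=> /(congr1 (fun q => (y * q)%g)); rewrite !mulgA yc !mule.
exists (fun q => (phi (repr q))^-1); split; last first.
  move=> a b; rewrite -invgM -phiM; congr (_^-1).
  by apply/CE; rewrite reprK quotient_piM !reprK.
(* A preimage of [u^-1] rather than of [u], to undo the inversion in the antiisomorphism. *)
pose sec u := \pi_(quotient C) (projT1 (cid (phi_surj u^-1))).
have secE u : phi (repr (sec u)) = u^-1.
  rewrite -(projT2 (cid (phi_surj u^-1))).
  by apply/CE; rewrite reprK.
exists sec => [q|u]; last by rewrite secE invgK.
by rewrite -[RHS]reprK -[LHS]reprK; apply/CE; rewrite secE invgK.
Qed.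

End LeastGroupCongruence.

Section Translations.
Local Open Scope group_scope.
Local Open Scope order_scope.
Variables (d : Order.disp_t) (G : loGroupType d).
Implicit Types (f : partial_map G) (u v w x : G).

(** The germ of [f] at the upper end of the order is right translation by [u]. The strict bound
    [w < x] serves [alpha] and [alphao] alike. *)
Definition eventual_shift f u : Prop :=
  exists w, forall x, w < x -> f x = Some (x * u)%g.

(** If [u < v], right multiplication by [u^-1 * v] strictly increases every element. Hence some
    point lies beyond both thresholds, and cancelling it there gives [u = v]. *)
Lemma eventual_shift_inj f u v :
  eventual_shift f u -> eventual_shift f v -> u = v.
Proof.
wlog uv : u v / u < v => [wl fu fv|].
  by case: (ltgtP u v) => // uv; [|apply/esym]; exact: wl.
move=> [w fu] [w' fv].
have lt_w x : x < (x * (u^-1 * v))%g.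
  have := lt_neqAle x (x * (u^-1 * v))%g => ->; apply/andP; split.
    apply: contraTneq uv => /(canLR (mulKg _)).
    rewrite mulVg => /(canLR (mulVKg _)); rewrite mulg1 => <-.
    by rewrite ltxx.
  rewrite -[leLHS]mulg1; apply/le_mulgl.
  by rewrite -(mulVg u); apply/le_mulgl/ltW.
have := lt_w (Order.max w w'); rewrite gt_max => /andP[/fu fx /fv].
by rewrite fx => -[] /mulgI.
Qed.

Lemma partial_map_mulE f f' x : (f * f')%g x = obind f' (f x).
Proof. by []. Qed.

Lemma eventual_shiftM f f' u v :
  eventual_shift f u -> eventual_shift f' v ->
  eventual_shift (f * f')%g (u * v)%g.
Proof.
(* Beyond [w' * u^-1], the shifted point [x * u] lies beyond [w']. *)
move=> [w fu] [w' fv]; exists (Order.max w (w' * u^-1)%g) => x.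
rewrite gt_max => /andP[wx w'x].
rewrite partial_map_mulE fu //= fv ?mulgA //.
by rewrite -(lt_mulgIr u) mulgVK in w'x.
Qed.

Lemma eventual_shift_translation f u v :
  f = alpha u v \/ f = alphao u v -> eventual_shift f (u^-1 * v)%g.
Proof.
move=> fE; exists u => x ux; rewrite mulgA.
by case: fE => ->; rewrite /alpha /alphao ?(ltW ux) ?ux.
Qed.

(** The factor [alphao w' w'] is the identity on the points above [w'], where both maps agree once
    [w'] is large. Allowing every large [w'] lets it be chosen in the positive cone. *)
Lemma eventual_shift_cancel f f' u :
  eventual_shift f u -> eventual_shift f' u ->
  exists w, forall w', w <= w' -> (alphao w' w' * f = alphao w' w' * f')%g.
Proof.
move=> [w fu] [w1 fu1]; exists (Order.max w w1) => w'.
rewrite ge_max => /andP[ww' w1w'].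
apply: funext => x; rewrite !partial_map_mulE /alphao.
case: ifP => //= w'x; rewrite mulgVK fu ?fu1 //; exact: le_lt_trans w'x.
Qed.

(** This treats both semigroups at once: preimages are required only for open-domain translations
    with positive parameters, which both contain. *)
Lemma antiiso_of_translations (S : semigroupType) (val : S -> partial_map G) :
  injective val -> {morph val : a b / (a * b)%g} ->
  (forall s, exists g h, val s = alpha g h \/ val s = alphao g h) ->
  (forall g h, pos_cone g -> pos_cone h -> exists s, val s = alphao g h) ->
  forall C : congruence S,
    least_group_congruence C -> antiisomorphic (quotient C) G.
Proof.
move=> val_inj valM valE val_surj C.
have shift s : exists u, eventual_shift (val s) u.
  by have [g [h /eventual_shift_translation]] := valE s; exists (g^-1 * h)%g.
(* The shift is picked by choice, but its uniqueness determines [phi]. *)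
pose phi s := projT1 (cid (shift s)).
have phiP s : eventual_shift (val s) (phi s) by exact: projT2 (cid (shift s)).
have phiE s u : eventual_shift (val s) u -> phi s = u.
  exact: eventual_shift_inj (phiP s).
apply: (@least_group_congruence_antiiso _ _ phi).
- by move=> a b; apply: phiE; rewrite valM; apply: eventual_shiftM.
- move=> u.
  (* Every element is a quotient of positive ones: [1^-1 * u] if [1 <= u], and [(u^-1)^-1 * 1]
     otherwise. *)
  suff [g [h [g1 h1 <-]]] : exists g h,
      [/\ pos_cone g, pos_cone h & g^-1 * h = u]%g.
    have [s sE] := val_surj g h g1 h1.
    by exists s; apply: phiE; apply: eventual_shift_translation; right.
  rewrite /pos_cone; have [u1|u1] := leP 1%g u.
    by exists 1%g, u; rewrite lexx invg1 mul1g.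
  exists u^-1%g, 1%g; rewrite lexx invgK mulg1; split=> //.
  by rewrite -(le_mulgIr u) mul1g mulVg ltW.
- move=> a b ab; have := phiP b; rewrite -ab => bP.
  have [w wP] := eventual_shift_cancel (phiP a) bP.
  (* Raising the threshold to at least [1] makes the restricted identity available in the positive
     case too. *)
  pose w' := Order.max w 1%g.
  have w'1 : pos_cone w' by rewrite /pos_cone le_max lexx orbT.
  have [c cE] := val_surj w' w' w'1 w'1.
  by exists c; apply: val_inj; rewrite !valM cE wP // le_max lexx.
Qed.

End Translations.

Theorem theorem3p13 (d : Order.disp_t) (G : loGroupType d) (hG : d_group G) :
  (forall C : congruence (Bbar G),
     least_group_congruence C -> antiisomorphic (quotient C) G) /\
  (forall C : congruence (Bbarp G),
     least_group_congruence C -> antiisomorphic (quotient C) G).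
Proof.
split.
- apply: (@antiiso_of_translations _ _ _ (@Bbar_val d G)).
  + exact: val_inj.
  + by [].
  + by move=> s; have := valP s; rewrite inE => /asboolP.
  + move=> g h _ _.
    have fP : alphao g h \in @Bbar_pred d G.
      by rewrite inE; apply/asboolP; exists g, h; right.
    by exists (MkBbar fP).
- apply: (@antiiso_of_translations _ _ _ (@Bbarp_val d G)).
  + exact: val_inj.
  + by [].
  + move=> s; have := valP s; rewrite inE => /asboolP[g [h [_ _ sE]]].
    by exists g, h.
  + move=> g h g1 h1.
    have fP : alphao g h \in @Bbarp_pred d G.
      by rewrite inE; apply/asboolP; exists g, h; split=> //; right.
    by exists (MkBbarp fP).
Qed.
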